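(* For every real $x\geq 11$ there exists at least one Ramanujan prime in the interval $\left(\frac{x}{2},x\right]$. Moreover, $\pi_R(x)-\pi_R\left(\frac{x}{2}\right)\to\infty$ as $x\to\infty$.
   Context: $\pi(x)$ denotes the number of primes $\leq x$. For $n\geq1$, the $n$th Ramanujan prime $R_n$ is the smallest positive integer with the property that if $x\geq R_n$ then $\pi(x)-\pi(x/2)\geq n$. $\pi_R(x)$ denotes the number of Ramanujan primes $\leq x$. *)

(* Defs.v *)
From mathcomp Require Import all_boot all_order all_algebra.
From mathcomp Require Import finmap.
From mathcomp Require Import all_classical all_reals all_analysis.

Set Implicit Arguments.
Unset Strict Implicit.
Unset Printing Implicit Defensive.
Import Order.TTheory GRing.Theory Num.Theory.
Import numFieldNormedType.Exports.
Local Open Scope classical_set_scope.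
Local Open Scope ring_scope.

(* The set below is always finite, so [fset_set] never takes its default
   value [fset0] (used for infinite sets). *)
Definition count_upto (R : realType) (A : set nat) (x : R) : nat :=
  #|` fset_set [set p | A p /\ p%:R <= x] |%fset.

Definition primepi (R : realType) (x : R) : nat :=
  count_upto [set p | prime p] x.

(* The difference is taken in [int], not with truncated subtraction. *)
Definition ramanujan_bound (R : realType) (n m : nat) : Prop :=
  forall x : R, m%:R <= x ->
    n%:Z <= (primepi x)%:Z - (primepi (x / 2))%:Z.

(* "m is the n-th Ramanujan prime", as a relation, so that no default value
   is needed before existence is known. *)
Definition is_nth_ramanujan (R : realType) (n m : nat) : Prop :=
  [/\ (0 < m)%N, ramanujan_bound R n m &
      forall k : nat, (0 < k)%N -> ramanujan_bound R n k -> (m <= k)%N].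

Definition ramanujan_primes (R : realType) : set nat :=
  [set p | exists2 n, (1 <= n)%N & is_nth_ramanujan R n p].

Definition ramanujanpi (R : realType) (x : R) : nat :=
  count_upto (ramanujan_primes R) x.

(* Main.v *)
(** Write F n = pi(n) - pi(n/2).  The n-th Ramanujan prime R_n satisfies
    F R_n = n, so distinct indices give distinct primes, and R_n lies in (a, b]
    as soon as F a < n while F k >= n for all k >= b.  With a = n/2 and b = n it
    is therefore enough to bound F k - F (n/2) from below for all k >= n.

    For n >= 2^16 this is done à la Chebyshev: for integers c_d with
    sum c_d/d = 0, the number sum c_d ln (n/d)! is both kappa n + O(ln n) by
    Stirling and sum_(p^j <= n) A(n/p^j) ln p with A(t) = sum c_d floor(t/d).
    If A >= 1_[1,2) this bounds F from above, and if
    A <= 1_[1,2) + 1_[121,oo) it bounds F from below, up to the contribution of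
    the primes below sqrt n and n/121.  Two such combinations give constants
    whose comparison only uses 9 >= 8, i.e. 2 ln 3 >= 3 ln 2.

    For n < 2^16 a sieve certifies a chain of Ramanujan primes starting at 11,
    each at most twice its predecessor. *)
From Stdlib Require Import NArith.
Require Import Defs.
From mathcomp Require Import all_boot all_order all_algebra.
From mathcomp Require Import finmap.
From mathcomp Require Import all_classical all_reals all_analysis.
From mathcomp Require Import zify ring lra.
Import Order.TTheory GRing.Theory Num.Theory.
Import numFieldNormedType.Exports.
Local Open Scope classical_set_scope.
Local Open Scope ring_scope.

(** * Primes in (n/2, n] and a certified sieve *)

Definition nprimes (n : nat) : nat := \sum_(0 <= p < n.+1) prime p.

(** The F of the overview; the truncated subtraction is exact because [nprimes] is monotone. *)
Definition half_primes (n : nat) : nat := (nprimes n - nprimes n./2)%N.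

Lemma nprimesS n : nprimes n.+1 = (nprimes n + prime n.+1)%N.
Proof. by rewrite /nprimes big_nat_recr. Qed.

Lemma nprimes0 : nprimes 0 = 0%N.
Proof. by rewrite /nprimes big_nat1. Qed.

Lemma leq_nprimes m n : (m <= n)%N -> (nprimes m <= nprimes n)%N.
Proof.
move=> /subnKC <-; elim: (n - m)%N => [|k IHk]; first by rewrite addn0.
by rewrite addnS nprimesS (leq_trans IHk) ?leq_addr.
Qed.

Lemma nprimes_half n : nprimes n = (nprimes n./2 + half_primes n)%N.
Proof. by rewrite /half_primes subnKC// leq_nprimes//; lia. Qed.

(** The half [n./2] advances only at odd [n], so one step of F needs two primality lookups. The
    additive form avoids truncated subtraction. *)
Lemma half_primesS n : (half_primes n.+1 + (odd n && prime n.+1./2) =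
  half_primes n + prime n.+1)%N.
Proof.
have := nprimesS n; rewrite nprimes_half (nprimes_half n).
have -> : nprimes n.+1./2 = (nprimes n./2 + (odd n && prime n.+1./2))%N.
  rewrite /= uphalf_half; case: (odd n) => /=; last by rewrite addn0.
  by rewrite !add1n nprimesS.
lia.
Qed.

(* Clears the entries of index [c], [c + p.+1], [c + 2 * p.+1], ...; the unary
   countdown [c] keeps the evaluation of the sieve free of arithmetic. *)
Fixpoint unmark (p c : nat) (s : seq bool) : seq bool :=
  if s is b :: s' then
    if c is c'.+1 then b :: unmark p c' s' else false :: unmark p p s'
  else [::].

Lemma nth_unmark p c s i : nth false (unmark p c s) i =
  nth false s i && ~~ ((c <= i)%N && (p.+1 %| i - c)%N).
Proof.
elim: s c i => [|b s IHs] [|c] [|i] //=; rewrite ?andbF ?andbT ?IHs//.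
rewrite subn0; case: (leqP p i) => pi /=.
  have -> : i.+1 = ((i - p) + p.+1)%N by rewrite addnS subnK.
  by rewrite dvdn_addl.
by rewrite gtnNdvd// andbT.
Qed.

Lemma size_unmark p c s : size (unmark p c s) = size s.
Proof. by elim: s c => [|b s IHs] [|c] //=; rewrite IHs. Qed.

(** Clearing starts at [p + p], so that [p] itself survives; [p.-1] compensates for the step [p.+1]
    of [unmark]. *)
Definition sieve (m n : nat) : seq bool :=
  foldr (fun p => unmark p.-1 (p + p)) [:: false, false & nseq n true]
    [seq p <- iota 2 m | prime p].

Lemma size_sieve m n : size (sieve m n) = n.+2.
Proof.
rewrite /sieve; elim: [seq _ <- _ | _] => [|p s IHs] /=; first by rewrite size_nseq.
by rewrite size_unmark.
Qed.

(** A composite [i] below [(m + 2)^2] has a least prime factor p with p^2 <= i. Hence p < m + 2 is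
    among the sieving primes, and p + p <= p^2 <= i puts [i] in the range it clears. *)
Lemma nth_sieve m n i : (i < n.+2)%N -> (i < m.+2 ^ 2)%N ->
  nth false (sieve m n) i = prime i.
Proof.
move=> ltin ltim; transitivity [&& (1 < i)%N &
  all (fun p => ~~ ((p + p <= i)%N && (p %| i)%N)) [seq p <- iota 2 m | prime p]].
  rewrite /sieve; have := filter_all prime (iota 2 m).
  elim: [seq _ <- _ | _] => [_|p s IHs /= /andP[/prime_gt0 p0 /IHs IH]].
    rewrite andbT; case: i ltin {ltim} => [|[|i]] //= ltin.
    by rewrite nth_nseq; have -> : (i < n)%N = true by exact: ltin.
  rewrite nth_unmark IH prednK//.
  case: (leqP (p + p) i) => pi /=; last by rewrite andbT.
  have -> : (p %| i - (p + p))%N = (p %| i)%N.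
    by rewrite dvdn_subl ?dvdn_addl.
  by rewrite andbAC andbA.
apply/idP/idP => [/andP[i1 /allP ni]|pi].
  apply/negPn/negP => npi; have pp := pdiv_prime i1.
  have lep : (pdiv i ^ 2 <= i)%N.
    by rewrite leqNgt; apply: contra npi; apply: ltn_pdiv2_prime; lia.
  have p1 := prime_gt1 pp; have pm : (pdiv i < m.+2)%N.
    by rewrite -ltn_sqr (leq_ltn_trans lep).
  have /ni : pdiv i \in [seq p <- iota 2 m | prime p].
    by rewrite mem_filter pp mem_iota p1.
  rewrite pdiv_dvd andbT; case/negP; apply: leq_trans lep.
  by rewrite addnn -mul2n expnS expn1 leq_mul2r p1 orbT.
apply/andP; split; first exact: prime_gt1.
apply/allP => p; rewrite mem_filter => /andP[pp _].
rewrite negb_and -ltnNge orbC -implybE; apply/implyP.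
rewrite (dvdn_prime2 pp pi) => /eqP->.
by have := prime_gt0 pi; lia.
Qed.

(* Starting from [f = half_primes k] with [s] and [h] listing the primality of
   [k + 1, k + 2, ...] and of [k./2 + 1, k./2 + 2, ...], with [b] the parity of
   [k], checks for each [(m, n')] of [ch] that [half_primes] stays at least [n']
   from [m] on and is below [n'] just before. *)
Fixpoint scan (s h : seq bool) (b : bool) (k f n : N) (ch : seq (N * N)) :=
  if s is x :: s' then
    let k' := N.succ k in
    let f1 := if x then N.succ f else f in
    let f' := if b && head false h then N.pred f1 else f1 in
    let h' := if b then behead h else h in
    if ch is (m, n') :: ch' then
      if N.eqb k' m then
        [&& N.ltb f n', N.leb n' f', N.leb n n' & scan s' h' (~~ b) k' f' n' ch']
      else N.leb n f' && scan s' h' (~~ b) k' f' n ch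
    else N.leb n f' && scan s' h' (~~ b) k' f' n ch
  else nilp ch.

(* Pairs (R_n, n). *)
Definition chain : seq (N * N) :=
  [:: (11, 2); (17, 3); (29, 4); (47, 6); (71, 9); (127, 13); (241, 23);
      (461, 39); (881, 67); (1733, 120); (3461, 215); (6869, 403); (13709, 740);
      (27397, 1374); (32771, 1613)]%num.

(** Sieving by the primes below 256 is correct below 2^16 = 65534 + 2. From [k = 0] both lookahead
    lists start at 1, hence the same list twice. *)
Lemma chain_scan :
  scan (behead (sieve 254 (N.to_nat 65534))) (behead (sieve 254 (N.to_nat 65534)))
    false 0 0 0 chain.
Proof. by vm_compute. Qed.

(** Induction on [s]. The thresholds never decrease along the chain, so comparing each value with
    the current one settles all earlier ones; the final [nilp] ensures that no pair was missed. *)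
Lemma scanP (s h : seq bool) (b : bool) (k f n : N) (ch : seq (N * N)) :
    (forall i, (i < size s)%N -> nth false s i = prime (N.to_nat k + i).+1) ->
    (forall i, (i < size s)%N ->
      nth false h i = prime ((N.to_nat k)./2 + i).+1) ->
    b = odd (N.to_nat k) -> N.to_nat f = half_primes (N.to_nat k) ->
    scan s h b k f n ch ->
  (forall j, (N.to_nat k < j <= N.to_nat k + size s)%N ->
    (N.to_nat n <= half_primes j)%N) /\
  (forall c, c \in ch -> [/\ (N.to_nat k < N.to_nat c.1)%N,
    (half_primes (N.to_nat c.1).-1 < N.to_nat c.2)%N &
    forall j, (N.to_nat c.1 <= j <= N.to_nat k + size s)%N ->
      (N.to_nat c.2 <= half_primes j)%N]).
Proof.
elim: s h b k f n ch => [|x s IHs] h b k f n ch.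
  by move=> _ _ _ _ /= /nilP ->; split=> // j /=; lia.
move=> Ps Ph bk fk /=.
set f' := if b && head false h then _ else _.
have xE : x = prime (N.to_nat k).+1 by have := Ps 0%N isT; rewrite addn0.
have hE : head false h = prime (N.to_nat k)./2.+1.
  by have := Ph 0%N isT; rewrite addn0 nth0.
have f'E : N.to_nat f' = half_primes (N.to_nat (N.succ k)).
  have := half_primesS (N.to_nat k); rewrite -fk -xE -bk.
  have -> : b && prime (N.to_nat k).+1./2 = b && head false h.
    by rewrite hE bk /= uphalf_half; case: odd => //=; rewrite add1n.
  rewrite N2Nat.inj_succ /f'.
  by case: (b && head false h); case: (x) => /=; lia.
have Ps' i : (i < size s)%N ->
    nth false s i = prime (N.to_nat (N.succ k) + i).+1.
  by move=> si; rewrite N2Nat.inj_succ addSnnS; apply: (Ps i.+1).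
have Ph' i : (i < size s)%N -> nth false (if b then behead h else h) i =
    prime ((N.to_nat (N.succ k))./2 + i).+1.
  move=> si; rewrite N2Nat.inj_succ /= uphalf_half -bk.
  case: b {bk f' IHs f'E} => /=; last by rewrite Ph// ltnW.
  by rewrite nth_behead Ph// add1n addSnnS.
have bk' : ~~ b = odd (N.to_nat (N.succ k)) by rewrite N2Nat.inj_succ /= bk.
have {}IHs n' ch' := IHs _ _ _ _ n' ch' Ps' Ph' bk' f'E.
have fj n' : (N.to_nat n' <= N.to_nat f')%N ->
    (forall j, (N.to_nat (N.succ k) < j <= N.to_nat (N.succ k) + size s)%N ->
      (N.to_nat n' <= half_primes j)%N) ->
    forall j, (N.to_nat k < j <= N.to_nat k + (size s).+1)%N ->
      (N.to_nat n' <= half_primes j)%N.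
  move=> nf sj j kj; have [->|jk] := eqVneq j (N.to_nat (N.succ k)).
    by rewrite -f'E.
  by apply: sj; lia.
have step : N.leb n f' && scan s (if b then behead h else h) (~~ b) (N.succ k)
    f' n ch -> (forall j, (N.to_nat k < j <= N.to_nat k + (size s).+1)%N ->
    (N.to_nat n <= half_primes j)%N) /\
  (forall c, c \in ch -> [/\ (N.to_nat k < N.to_nat c.1)%N,
    (half_primes (N.to_nat c.1).-1 < N.to_nat c.2)%N &
    forall j, (N.to_nat c.1 <= j <= N.to_nat k + (size s).+1)%N ->
      (N.to_nat c.2 <= half_primes j)%N]).
  move=> /andP[/N.leb_le nf /IHs[nj chj]]; split; first by apply: fj => //; lia.
  move=> c /chj[kc c1 c2]; split=> //; first by lia.
  by move=> j cj; apply: c2; lia.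
case: ch step => [//|[m n'] ch step]; case: ifP => [/N.eqb_eq km|_]; last exact: step.
case/and4P => /N.ltb_lt fn' /N.leb_le n'f /N.leb_le nn' /IHs[nj chj].
have {}nj : forall j, (N.to_nat k < j <= N.to_nat k + (size s).+1)%N ->
    (N.to_nat n' <= half_primes j)%N by apply: fj => //; lia.
split; first by move=> j /nj; lia.
move=> c; rewrite in_cons => /orP[/eqP -> /=|/chj[kc c1 c2]].
  rewrite -km N2Nat.inj_succ /= -fk; split; [by []|by lia|].
  by move=> j ?; apply: nj; lia.
rewrite N2Nat.inj_succ addSnnS in kc c2.
by split=> //; apply: ltnW.
Qed.

Lemma scan_sieveP (m n : nat) (ch : seq (N * N)) : (n.+2 <= m.+2 ^ 2)%N ->
    scan (behead (sieve m n)) (behead (sieve m n)) false 0 0 0 ch ->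
  forall c, c \in ch -> (half_primes (N.to_nat c.1).-1 < N.to_nat c.2)%N /\
    forall j, (N.to_nat c.1 <= j < n.+2)%N -> (N.to_nat c.2 <= half_primes j)%N.
Proof.
move=> mn sc c cch.
have sM : size (behead (sieve m n)) = n.+1 by rewrite size_behead size_sieve.
have sP i : (i < size (behead (sieve m n)))%N ->
    nth false (behead (sieve m n)) i = prime i.+1.
  rewrite sM => iM; rewrite nth_behead nth_sieve//.
  by apply: leq_trans mn.
have [//|_ /(_ c cch)[_ c1 c2]] :=
  scanP _ _ false 0%num 0%num 0%num ch sP sP erefl _ sc.
  by rewrite /half_primes subnn.
by split=> // j cj; apply: c2; rewrite sM.
Qed.

Lemma chainP c : c \in chain ->
  (half_primes (N.to_nat c.1).-1 < N.to_nat c.2)%N /\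
  forall j, (N.to_nat c.1 <= j < 2 ^ 16)%N -> (N.to_nat c.2 <= half_primes j)%N.
Proof.
have e16 : ((N.to_nat 65534).+2 == 2 ^ 16)%N by vm_compute.
(* The size is abstracted to a variable so that 65534 is not unfolded in unary. *)
have := chain_scan; move: (N.to_nat 65534) e16 => n /eqP e16 sc cch.
rewrite -e16; apply: scan_sieveP sc c cch.
by rewrite e16 (expnM 2 8 2).
Qed.

(** * Stirling bounds and Chebyshev combinations *)

(** This is ln (1 + u) <= u at u = y / x - 1. Used with [x] and [y] in both orders, it bounds
    differences of logarithms from both sides. *)
Lemma ln_mul_le (R : realType) (x y : R) : 0 < x -> 0 < y ->
  x * (ln y - ln x) <= y - x.
Proof.
move=> x0 y0; rewrite -ln_div ?posrE//.
have yx0 : 0 < y / x by rewrite divr_gt0.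
have := @le_ln1Dx R (y / x - 1); rewrite subrKC => /(_ _)/(ler_wpM2l (ltW x0)).
have -> : x * (y / x - 1) = y - x by field; lra.
by apply; lra.
Qed.

Lemma ln_factS (R : realType) (n : nat) :
  ln (n.+1`!%:R : R) = ln n.+1%:R + ln n`!%:R.
Proof. by rewrite factS natrM lnM// posrE ltr0n// fact_gt0. Qed.

Lemma ln_fact_lower (R : realType) (n : nat) : (0 < n)%N ->
  n%:R * ln n%:R - n%:R + 1 <= ln (n`!%:R : R).
Proof.
elim: n => [//|[|n] IHn] _; first by rewrite (_ : 1`! = 1)%N// ln1; lra.
rewrite ln_factS.
have := @ln_mul_le R n.+1%:R n.+2%:R; rewrite !ltr0n => /(_ isT isT).
move: (IHn isT); rewrite -[n.+2]addn1 natrD; set a : R := n.+1%:R.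
by move: (ln _) (ln a) (ln (_ + _)) => f la lb; nra.
Qed.

Lemma ln_fact_upper (R : realType) (n : nat) : (0 < n)%N ->
  ln (n`!%:R : R) <= (n%:R + 1) * ln n%:R - n%:R + 1.
Proof.
elim: n => [//|[|n] IHn] _; first by rewrite (_ : 1`! = 1)%N// ln1; lra.
rewrite ln_factS.
have := @ln_mul_le R n.+2%:R n.+1%:R; rewrite !ltr0n => /(_ isT isT).
move: (IHn isT); rewrite -[n.+2]addn1 natrD; set a : R := n.+1%:R.
by move: (ln _) (ln a) (ln (_ + _)) => f la lb; nra.
Qed.

(** Put g(x) = x ln x - x + 1. The two preceding bounds place ln m! in [g(m), g(m) + ln m], and 0 <=
    g(x) - g(m) <= (x - m) ln x <= ln x. *)
Lemma ln_fact_stirling (R : realType) (m : nat) (x : R) : (0 < m)%N ->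
  m%:R <= x < m%:R + 1 -> `|ln m`!%:R - (x * ln x - x + 1)| <= ln x.
Proof.
move=> m0 /andP[mx xm]; have m0R : 0 < m%:R :> R by rewrite ltr0n.
have m1R : 1 <= m%:R :> R by rewrite ler1n.
have x0 : 0 < x by lra.
have lm0 : 0 <= ln (m%:R : R) by rewrite ln_ge0.
have lmx : ln (m%:R : R) <= ln x by rewrite ler_ln ?posrE.
have h1 := @ln_mul_le R m%:R x m0R x0.
have h2 := @ln_mul_le R x m%:R x0 m0R.
have lo := @ln_fact_lower R m m0.
have up := @ln_fact_upper R m m0.
rewrite ler_norml; apply/andP; split; nra.
Qed.

Lemma ln_fact_divn (R : realType) (n d : nat) : (0 < d <= n)%N ->
  `|ln (n %/ d)`!%:R - (n%:R / d%:R * ln (n%:R / d%:R) - n%:R / d%:R + 1)|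
    <= ln n%:R :> R.
Proof.
move=> /andP[d0 dn]; set x : R := n%:R / d%:R; have d0R : 0 < d%:R :> R by rewrite ltr0n.
have n0R : 0 < n%:R :> R by rewrite ltr0n (leq_trans d0).
apply: (@le_trans _ _ (ln x)).
  apply: ln_fact_stirling; first by rewrite divn_gt0.
  rewrite /x ler_pdivlMr// ltr_pdivrMr// -natrM ler_nat leq_divM/=.
  by rewrite natr1 -natrM ltr_nat ltn_ceil.
by rewrite ler_ln ?posrE ?divr_gt0// ler_pdivrMr// ler_peMr ?ler1n.
Qed.

Lemma ln_prodn (R : realType) (I : Type) (r : seq I) (P : pred I)
    (F : I -> nat) : (forall i, P i -> (0 < F i)%N) ->
  ln (\prod_(i <- r | P i) F i)%:R = \sum_(i <- r | P i) ln ((F i)%:R : R).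
Proof.
move=> F0; elim: r => [|i r IHr]; first by rewrite !big_nil ln1.
rewrite !big_cons; case: ifP => // Pi.
rewrite natrM lnM ?IHr// posrE ltr0n ?F0//.
by apply: prodn_cond_gt0.
Qed.

Lemma ln_natE (R : realType) (m N : nat) : (0 < m <= N)%N ->
  ln (m%:R : R) = \sum_(0 <= p < N.+1 | prime p) (logn p m)%:R * ln p%:R.
Proof.
move=> /andP[m0 mN].
have mE : m = (\prod_(0 <= p < N.+1 | prime p) p ^ logn p m)%N.
  rewrite -{1}(partnT m0) /partn (@big_nat_widen _ _ _ 0 m.+1 N.+1)//.
  rewrite big_mkcond [RHS]big_mkcond; apply: eq_bigr => p _ /=.
  case: ltnP => [_|/ltn_log0 ->]; last by rewrite expn0 if_same.
  by rewrite lognE; case: (prime p); rewrite /= ?expn0.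
rewrite {1}mE ln_prodn.
  apply: eq_bigr => p pp; rewrite natrX lnXn ?mulr_natl//.
  by rewrite ltr0n prime_gt0.
by move=> p pp; rewrite expn_gt0 prime_gt0.
Qed.

(** Legendre's formula. The free bound [N] gives all factorials of a combination the same index
    ranges; the added terms vanish. *)
Lemma ln_factE (R : realType) (n N : nat) : (n <= N)%N ->
  ln (n`!%:R : R) = \sum_(0 <= p < N.+1 | prime p)
    \sum_(1 <= k < N.+1) (n %/ p ^ k)%N%:R * ln p%:R.
Proof.
move=> nN; transitivity (\sum_(0 <= p < N.+1 | prime p)
    (logn p n`!)%:R * ln (p%:R : R)).
  elim: n nN => [|n IHn] nN.
    by rewrite ln1 big1// => p _; rewrite logn1 mul0r.
  rewrite ln_factS IHn ?(ltnW nN)// (@ln_natE _ _ N)// -big_split.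
  apply: eq_bigr => p _ /=.
  by rewrite factS lognM ?fact_gt0// natrD mulrDl.
apply: eq_bigr => p pp; rewrite -mulr_suml -natr_sum logn_fact//.
rewrite [in RHS](@big_cat_nat _ _ _ n.+1)//= [X in (_ + X)%N]big_nat_cond.
rewrite [X in (_ + X)%N]big1 ?addn0// => k /andP[/andP[nk _] _].
by rewrite divn_small// (leq_trans nk)// ltnW// ltn_expl// prime_gt1.
Qed.

(** The function A of the overview, the list holding the pairs (c_d, d). *)
Definition floor_comb (s : seq (int * nat)) (t : nat) : int :=
  \sum_(c <- s) c.1 * (t %/ c.2)%N%:Z.

Definition ln_fact_comb (R : realType) (s : seq (int * nat)) (n : nat) : R :=
  \sum_(c <- s) c.1%:~R * ln (n %/ c.2)`!%:R.

(** After Legendre's formula, floor(floor(n/d)/p^k) = floor(floor(n/p^k)/d) lets the sum over d be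
    taken innermost. *)
Lemma ln_fact_combE (R : realType) (s : seq (int * nat)) (n : nat) :
  ln_fact_comb R s n = \sum_(0 <= p < n.+1 | prime p)
    \sum_(1 <= k < n.+1) (floor_comb s (n %/ p ^ k))%:~R * ln p%:R.
Proof.
rewrite /ln_fact_comb; under eq_bigr => c _.
  rewrite (@ln_factE _ _ n) ?leq_div// mulr_sumr.
  under eq_bigr => p _ do rewrite mulr_sumr.
  over.
rewrite exchange_big; apply: eq_bigr => p _ /=.
rewrite exchange_big; apply: eq_bigr => k _ /=.
rewrite /floor_comb rmorph_sum mulr_suml; apply: eq_bigr => c _ /=.
by rewrite rmorphM mulrA divnAC.
Qed.

(** Since sum c_d/d = 0, the n ln n and n terms of Stirling's formula cancel; each factorial leaves
    an error of at most |c_d| ln n. *)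
Lemma ln_fact_comb_approx (R : realType) (s : seq (int * nat)) (n : nat) :
    (forall c, c \in s -> (0 < c.2 <= n)%N) ->
    \sum_(c <- s) c.1%:~R / c.2%:R = 0 :> R ->
  `|ln_fact_comb R s n - (- n%:R * (\sum_(c <- s) c.1%:~R * (ln c.2%:R / c.2%:R))
     + \sum_(c <- s) c.1%:~R)| <= (\sum_(c <- s) `|c.1|)%:~R * ln n%:R.
Proof.
move=> sn s0.
have n0 c : c \in s -> 0 < c.2%:R :> R /\ 0 < n%:R :> R.
  by move=> /sn /andP[c0 cn]; rewrite !ltr0n c0 (leq_trans c0).
have -> : - n%:R * (\sum_(c <- s) c.1%:~R * (ln c.2%:R / c.2%:R)) +
    \sum_(c <- s) c.1%:~R = \sum_(c <- s) c.1%:~R *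
    (n%:R / c.2%:R * ln (n%:R / c.2%:R) - n%:R / c.2%:R + 1) :> R.
  (* A multiple of the vanishing sum is added so that the identity holds term by term. *)
  transitivity (- n%:R * (\sum_(c <- s) c.1%:~R * (ln c.2%:R / c.2%:R)) +
    \sum_(c <- s) c.1%:~R + n%:R * (ln n%:R - 1) *
    \sum_(c <- s) c.1%:~R / c.2%:R : R); first by rewrite s0 mulr0 addr0.
  rewrite !mulr_sumr -!big_split /=; apply: eq_big_seq => c /n0[c0 n0R].
  by rewrite ln_div ?posrE//; field; lra.
rewrite /ln_fact_comb -sumrB rmorph_sum mulr_suml.
apply: le_trans (ler_norm_sum _ _ _) _; rewrite !big_seq; apply: ler_sum => c cs.
rewrite -mulrBr normrM /= intr_norm ler_wpM2l//.
by apply: ln_fact_divn; apply: sn.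
Qed.

(** * Erdős's bound on the product of the primes up to n *)

Lemma bin_odd_central_le (m : nat) : ('C(m.*2.+1, m) <= 4 ^ m)%N.
Proof.
have mm : (m.+1 < m.*2.+2)%N by lia.
have mm' : (m < m.*2.+2)%N by lia.
have bE : 'C(m.*2.+1, m.+1) = 'C(m.*2.+1, m).
  by rewrite -bin_sub; [congr 'C(_, _)|]; lia.
(* Two equal terms in the expansion of (1 + 1)^(2m + 1). *)
have : ('C(m.*2.+1, m) + 'C(m.*2.+1, m) <= 2 ^ m.*2.+1)%N.
  rewrite -{2}bE (expnDn 1 1) (bigD1 (Ordinal mm'))//= (bigD1 (Ordinal mm))/=.
    by rewrite !exp1n !muln1 leq_add2l leq_addr.
  by rewrite -val_eqE /= eqn_leq ltnn.
have -> : (4 ^ m = 2 ^ m.*2)%N by rewrite -mul2n expnM.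
by rewrite expnS; lia.
Qed.

Lemma prime_dvdn_fact (p n : nat) : prime p -> (p %| n`!)%N = (p <= n)%N.
Proof.
move=> pp; apply/idP/idP => [|pn]; last by rewrite dvdn_fact// prime_gt0.
elim: n => [|n IHn]; first by rewrite dvdn1 => /eqP pE; rewrite pE in pp.
rewrite factS Euclid_dvdM// => /orP[/dvdn_leq ->//|/IHn].
exact: leqW.
Qed.

Lemma prod_primes_dvdn (m n N : nat) :
    (forall p, prime p -> (m <= p < n)%N -> (p %| N)%N) ->
  (\prod_(m <= p < n | prime p) p %| N)%N.
Proof.
move=> pN; apply/unstable.Gauss_dvd_prod; last first.
  by move=> p; rewrite mem_index_iota => pmn pp; apply: pN.
rewrite map_id; have : uniq [seq i <- index_iota m n | prime i].
  by rewrite filter_uniq// iota_uniq.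
have := filter_all prime (index_iota m n).
elim: [seq _ <- _ | _] => [//|p s IHs] /= /andP[pp ps] /andP[nps us].
rewrite IHs// andbT; apply/allP => q qs.
rewrite prime_coprime// dvdn_prime2//; last exact: (allP ps).
by apply: contra nps => /eqP ->.
Qed.

(** An even n > 2 reduces to n - 1. For n = 2m + 1 the primes in (m + 1, 2m + 1] all divide the
    binomial coefficient C(2m + 1, m) <= 4^m, and induction handles those up to m + 1. *)
Lemma primorial_le (n : nat) : (\prod_(0 <= p < n.+1 | prime p) p <= 4 ^ n)%N.
Proof.
elim/ltn_ind: n => n IHn.
have [n3|n3] := ltnP n 3.
  by case: n {IHn} n3 => [|[|[|//]]] _; rewrite unlock.
case/boolP: (odd n) => on; last first.
  have np : ~~ prime n by apply: contra on => /even_prime[nE|//]; lia.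
  rewrite big_mkcond big_nat_recr//= -big_mkcond (negbTE np) muln1.
  case: n IHn n3 {on np} => // n /(_ n (ltnSn n)) IHn _.
  by rewrite (leq_trans IHn)// leq_exp2l.
have [m nE] : exists m, n = m.*2.+1 by exists n./2; lia.
rewrite nE (@big_cat_nat _ _ _ m.+2)//=; last by lia.
have -> : (4 ^ m.*2.+1 = 4 ^ m.+1 * 4 ^ m)%N by rewrite -expnD; congr expn; lia.
apply: leq_mul; first by apply: IHn; lia.
apply: leq_trans (bin_odd_central_le m).
apply: dvdn_leq; first by rewrite bin_gt0; lia.
apply: prod_primes_dvdn => p pp /andP[mp pm].
have mn : (m <= m.*2.+1)%N by lia.
have := prime_dvdn_fact p m.*2.+1 pp; rewrite -(bin_fact mn) !Euclid_dvdM//.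
rewrite !prime_dvdn_fact//; have -> : (m.*2.+1 - m = m.+1)%N by lia.
have -> : (p <= m)%N = false by lia.
have -> : (p <= m.+1)%N = false by lia.
by rewrite !orbF => ->.
Qed.

Lemma chebyshev_theta_le (R : realType) (n : nat) :
  \sum_(0 <= p < n.+1 | prime p) ln (p%:R : R) <= n%:R * (ln 2 *+ 2).
Proof.
rewrite -ln_prodn; last by move=> p; exact: prime_gt0.
rewrite mulr_natl -lnXn// -lnXn ?exprn_gt0// -!natrX ler_ln ?posrE ?ltr0n//.
- by rewrite ler_nat primorial_le.
- by apply: prodn_cond_gt0 => p; exact: prime_gt0.
- by rewrite expn_gt0.
Qed.

(** Of two consecutive numbers beyond 2 only the odd one can be prime. This saves a factor 2 in
    counting the primes up to sqrt n. *)
Lemma nprimes_double_le (n : nat) : (nprimes n.*2 <= n)%N.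
Proof.
elim: n => [|[|n] IHn]; first by rewrite nprimes0.
  by rewrite /nprimes unlock.
rewrite (doubleS n.+1) (nprimesS n.+1.*2.+1) (nprimesS n.+1.*2).
have -> : prime n.+1.*2.+2 = false.
  by apply/negP => /even_prime[|]; lia.
by rewrite addn0 (leq_trans (leq_add IHn (leq_b1 _)))// addn1.
Qed.

(** A prime p lies in (n/2, n] exactly when floor(n/p) = 1, which is where the indicator of [1, 2)
    in the bounds on A comes from. *)
Lemma half_primesE (n : nat) :
  half_primes n = (\sum_(0 <= p < n.+1 | prime p) (n %/ p == 1))%N.
Proof.
rewrite /half_primes /nprimes (@big_cat_nat _ _ _ n./2.+1 0 n.+1)//=; last by lia.
rewrite addnC addnK (@big_cat_nat _ _ _ n./2.+1 0 n.+1)//=; last by lia.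
rewrite [in RHS]big_nat_cond [in RHS]big1 ?add0n; last first.
  move=> p /andP[/andP[_ pn] pp]; have p0 := prime_gt0 pp.
  by apply/eqP; rewrite eqb0 neq_ltn leq_divRL//; apply/orP; right; lia.
rewrite [in RHS]big_mkcond; apply: eq_big_nat => p /andP[np pn].
case: ifP => // pp; have p0 := prime_gt0 pp.
suff -> : (n %/ p)%N = 1%N by [].
by apply/eqP; rewrite eqn_leq leq_divRL// -ltnS ltn_divLR//; lia.
Qed.

(** * Bounds on F from Chebyshev combinations *)

Lemma floor_comb0 (s : seq (int * nat)) : floor_comb s 0 = 0.
Proof. by rewrite /floor_comb big1// => c _; rewrite div0n mulr0. Qed.

(** As A >= 0, it suffices to keep the terms k = 1 with floor(n/p) = 1; such a prime satisfies 2p >=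
    n + 1. *)
Lemma half_primes_upper (R : realType) (s : seq (int * nat)) (n : nat) :
    (forall t, (t == 1%N)%:Z <= floor_comb s t) ->
  (half_primes n)%:R * (ln n.+1%:R - ln 2) <= ln_fact_comb R s n.
Proof.
move=> s1; rewrite half_primesE ln_fact_combE natr_sum mulr_suml.
rewrite big_nat_cond [leRHS]big_nat_cond.
apply: ler_sum => p /andP[/andP[_ pn] pp].
have p1 : 1 <= p%:R :> R by rewrite ler1n prime_gt0.
have lp0 : 0 <= ln (p%:R : R) by rewrite ln_ge0.
have A0 t : 0 <= (floor_comb s t)%:~R :> R.
  by rewrite ler0z (le_trans _ (s1 t)).
rewrite big_ltn; last by rewrite (leq_trans _ pn)// ltnS prime_gt0.
rewrite expn1 ler_wpDr//; first by apply: sumr_ge0 => k _; rewrite mulr_ge0.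
have [np|_] := eqVneq (n %/ p)%N 1%N; last by rewrite mul0r mulr_ge0.
have A1 : 1 <= (floor_comb s 1)%:~R :> R by rewrite ler1z; exact: (s1 1%N).
have n2p : (n.+1 <= 2 * p)%N.
  by rewrite -ltn_divLR ?np// prime_gt0.
rewrite np mul1r lerBlDl (le_trans (y := ln 2 + ln p%:R))//; last first.
  by rewrite lerD2l ler_peMl.
rewrite -lnM ?posrE//; last by lra.
by rewrite -natrM ler_ln ?posrE ?ltr0n ?muln_gt0 ?(prime_gt0 pp)// ler_nat.
Qed.

(** If p^2 <= n, every A value is at most 1, as [1 < K] keeps the two indicators apart, and the
    powers p^k <= n contribute at most ln n in total. If p^2 > n, only k = 1 contributes. *)
Lemma sum_floor_comb_le (R : realType) (s : seq (int * nat)) (K n p : nat) :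
    (1 < K)%N ->
    (forall t, floor_comb s t <= (t == 1%N)%:Z + (K <= t)%N%:Z) ->
    prime p -> (p <= n)%N ->
  \sum_(1 <= k < n.+1) (floor_comb s (n %/ p ^ k))%:~R * ln (p%:R : R) <=
    ((n %/ p)%N == 1%N)%:R * ln n%:R + (p * p <= n)%N%:R * ln n%:R +
    (K <= n %/ p)%N%:R * ln p%:R.
Proof.
move=> K1 sK pp pn; have p1 := prime_gt1 pp; have p0 := prime_gt0 pp.
have n0 := leq_trans p0 pn.
have lp0 : 0 <= ln (p%:R : R) by rewrite ln_ge0// ler1n.
have lpn : ln (p%:R : R) <= ln n%:R by rewrite ler_ln ?posrE ?ltr0n// ler_nat.
have [ppn|npp] := leqP (p * p) n.
  have Kp0 : 0 <= (K <= n %/ p)%N%:R * ln (p%:R : R) by rewrite mulr_ge0.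
  have ln0 : 0 <= ln (n%:R : R) by rewrite ln_ge0// ler1n.
  rewrite mul1r; apply: (@le_trans _ _ (ln n%:R)); last first.
    by have : 0 <= ((n %/ p)%N == 1%N)%:R * ln (n%:R : R); [rewrite mulr_ge0|lra].
  set e := trunc_log p n.
  have [pe en] : (p ^ e <= n)%N /\ (n < p ^ e.+1)%N.
    by have /andP[] := trunc_log_bounds p1 n0.
  have e_n : (e < n)%N by apply: leq_trans pe; rewrite ltn_expl.
  rewrite (@big_cat_nat _ _ _ e.+1)//=; last by rewrite ltnS ltnW.
  rewrite [X in _ + X]big_nat_cond [X in _ + X]big1 ?addr0; last first.
    move=> k /andP[/andP[ek _] _]; rewrite divn_small ?floor_comb0 ?mul0r//.
    by rewrite (leq_trans en)// leq_exp2l.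
  apply: (@le_trans _ _ (\sum_(1 <= k < e.+1) ln (p%:R : R))).
    apply: ler_sum => k _; rewrite ler_piMl// lerz1.
    apply: le_trans (sK _) _; case: eqVneq => [->|_]; last by case: leqP.
    by rewrite leqNgt K1.
  rewrite sumr_const_nat subn1 -lnXn ?ltr0n// -natrX.
  by rewrite ler_ln ?posrE ?ltr0n ?expn_gt0 ?p0// ler_nat.
rewrite big_ltn; last by rewrite ltnS.
rewrite expn1 mul0r addr0 big_nat_cond big1 ?addr0; last first.
  move=> k /andP[/andP[k2 _] _]; rewrite divn_small ?floor_comb0 ?mul0r//.
  by rewrite (leq_trans npp)// -(expnS p 1) leq_exp2l.
apply: le_trans (ler_wpM2r lp0 (_ : _ <= ((n %/ p)%N == 1%N)%:R + (K <= n %/ p)%N%:R)) _.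
  by have := sK (n %/ p)%N; rewrite -(ler_int R) rmorphD.
by rewrite mulrDl lerD2r ler_wpM2l.
Qed.

(** Summed over p, the three terms of the previous bound give F(n) ln n, the count of primes up to
    sqrt n times ln n, and Chebyshev's theta at n/K. *)
Lemma half_primes_lower (R : realType) (s : seq (int * nat)) (K n : nat) :
    (1 < K)%N -> (0 < n)%N ->
    (forall t, floor_comb s t <= (t == 1%N)%:Z + (K <= t)%N%:Z) ->
  ln_fact_comb R s n <= ((half_primes n)%:R + (Num.sqrt n%:R + 1) / 2) * ln n%:R +
    n%:R / K%:R * (ln 2 *+ 2).
Proof.
move=> K1 n0 sK; have K0 := ltnW K1.
have ln0 : 0 <= ln (n%:R : R) by rewrite ln_ge0// ler1n.
have sqrt_count : (\sum_(0 <= p < n.+1 | prime p) (p * p <= n)%N)%N%:R <=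
    (Num.sqrt n%:R + 1) / 2 :> R.
  set q : R := Num.sqrt n%:R; have q0 : 0 <= q by rewrite sqrtr_ge0.
  have qq : q * q = n%:R by rewrite -expr2 sqr_sqrtr.
  set r := Num.truncn q; have /andP[rq qr] := truncn_itv q0.
  have rn : (r <= n)%N.
    rewrite -(ler_nat R) (le_trans rq)// -qq.
    have [->|] := eqVneq q 0; first by rewrite mul0r.
    by move=> qn0; rewrite ler_peMl//; rewrite -sqrtr1 ler_wsqrtr// ler1n.
  apply: (@le_trans _ _ (nprimes r)%:R).
    rewrite ler_nat /nprimes (@big_cat_nat _ _ _ r.+1)//=.
    rewrite [X in (_ + X)%N]big_nat_cond [X in (_ + X)%N]big1 ?addn0.
      by rewrite big_mkcond; apply: leq_sum => p _; case: ifP => // _; exact: leq_b1.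
    move=> p /andP[/andP[rp _] _]; apply/eqP; rewrite eqb0 -ltnNge -(ltr_nat R).
    have qp : q < p%:R by rewrite (lt_le_trans qr)// ler_nat.
    by rewrite natrM -qq; nra.
  have : (nprimes r <= uphalf r)%N.
    by apply: leq_trans (nprimes_double_le _); apply: leq_nprimes; lia.
  rewrite -(ler_nat R) => /le_trans; apply.
  have : ((uphalf r) * 2 <= r + 1)%N by lia.
  by rewrite -(ler_nat R) natrM natrD; lra.
have theta_le : \sum_(0 <= p < n.+1 | prime p) (K <= n %/ p)%N%:R * ln (p%:R : R)
    <= n%:R / K%:R * (ln 2 *+ 2).
  apply: (@le_trans _ _ (\sum_(0 <= p < (n %/ K).+1 | prime p) ln (p%:R : R))).
    rewrite (@big_nat_widen _ _ _ 0 (n %/ K).+1 n.+1); last by rewrite ltnS leq_div.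
    rewrite big_mkcondr; apply: ler_sum => p pp; have p0 := prime_gt0 pp.
    rewrite ltnS leq_divRL// mulnC -leq_divRL//.
    by case: ifP => _; rewrite ?mul1r ?mul0r.
  apply: le_trans (chebyshev_theta_le R _) _.
  rewrite ler_wpM2r ?mulrn_wge0 ?ln_ge0 ?ler1n//.
  by rewrite ler_pdivlMr ?ltr0n// -natrM ler_nat leq_divM.
rewrite ln_fact_combE; apply: le_trans.
  rewrite big_nat_cond; apply: ler_sum => p /andP[/andP[_ pn] pp].
  exact: (@sum_floor_comb_le R s K n p K1 sK pp pn).
rewrite -big_nat_cond !big_split /= mulrDl lerD// lerD//.
  by rewrite -mulr_suml half_primesE natr_sum.
by rewrite -mulr_suml -natr_sum ler_wpM2r.
Qed.

(** * Periodicity and the two explicit combinations *)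

Lemma floor_comb_mod (s : seq (int * nat)) (L t : nat) :
    (forall c, c \in s -> (0 < c.2)%N && (c.2 %| L)%N) -> floor_comb s L = 0 ->
  floor_comb s t = floor_comb s (t %% L).
Proof.
move=> sL sL0; transitivity
    (floor_comb s (t %% L) + (t %/ L)%N%:Z * floor_comb s L).
  rewrite /floor_comb mulr_sumr -big_split !big_seq; apply: eq_bigr => c /sL.
  (* For t = qL + r and d dividing L, floor(t/d) = q (L/d) + floor(r/d). *)
  case/andP => c0 cL /=; rewrite {1}(divn_eq t L) addnC.
  rewrite divnDr ?dvdn_mull// -muln_divA// mulrCA -mulrDr.
  by rewrite PoszD PoszM.
by rewrite sL0 mulr0 addr0.
Qed.

(* Pairs (c_d, d), found by linear programming over the divisors of 12 and of
   120. *)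
Definition upper_comb : seq (int * nat) :=
  [:: (1, 1%N); (-2, 2%N); (-1, 3%N); (1, 4%N); (1, 6%N); (-1, 12%N)]%Z.

Definition lower_comb : seq (int * nat) :=
  [:: (1, 1%N); (-2, 2%N); (-1, 3%N); (1, 4%N); (-1, 5%N); (1, 6%N); (1, 10%N);
      (-1, 12%N); (1, 15%N); (1, 40%N); (1, 120%N)]%Z.

Lemma upper_combP (t : nat) : (t == 1%N)%:Z <= floor_comb upper_comb t.
Proof.
rewrite (@floor_comb_mod _ 12); last by rewrite /floor_comb unlock.
  apply: (@le_trans _ _ ((t %% 12)%N == 1%N)%:Z); first by case: eqP => [->|].
  have : (t %% 12 < 12)%N by rewrite ltn_mod.
  rewrite /floor_comb unlock.
  by move: (t %% 12)%N; do 12 (case=> [//|]).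
by apply/allP.
Qed.

(** Over one period A is at most the indicator of 1. By periodicity the other arguments where A can
    be positive are 1 modulo 120, hence at least 121. *)
Lemma lower_combP (t : nat) :
  floor_comb lower_comb t <= (t == 1%N)%:Z + (121 <= t)%N%:Z.
Proof.
rewrite (@floor_comb_mod _ 120); last by rewrite /floor_comb unlock.
  apply: (@le_trans _ _ ((t %% 120)%N == 1%N)%:Z).
    have : (t %% 120 < 120)%N by rewrite ltn_mod.
    have : all (fun r => floor_comb lower_comb r <= (r == 1%N)%:Z) (iota 0 120).
      by rewrite /floor_comb unlock; vm_compute.
    by move=> /allP low tl; apply: low; rewrite mem_iota.
  have := divn_eq t 120; case: (t %/ 120)%N => [|q] tE.
    by move: tE; rewrite mul0n add0n => <-; rewrite lerDl.
  case: eqP tE => [->|_] tE; last by rewrite addr_ge0.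
  have -> : (120 < t)%N by lia.
  rewrite lerDr; case: (t == 1%N) => //.
by apply/allP.
Qed.

(** * Numerical estimates *)

Lemma ln2_ge_half (R : realType) : 1 / 2 <= ln (2 : R).
Proof.
have : (2 : R) * (ln 1 - ln 2) <= 1 - 2 by apply: ln_mul_le.
by rewrite ln1; lra.
Qed.

Lemma ln3_ge (R : realType) : 3 / 2 * ln 2 <= ln (3 : R).
Proof.
have : ln ((2 : R) ^+ 3) <= ln (3 ^+ 2).
  by rewrite ler_ln ?posrE ?exprn_gt0//; lra.
by rewrite !lnXn//; lra.
Qed.

(** With p = sqrt x and q = sqrt y, p (ln q - ln p) <= q - p <= (q - p) ln p, because ln p >= 1. *)
Lemma ln_sqrt_antitone (R : realType) (x y : R) : 0 < x -> x <= y -> 2 <= ln x ->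
  ln y * Num.sqrt x <= ln x * Num.sqrt y.
Proof.
move=> x0 xy lx; have y0 : 0 < y by lra.
have p0 : 0 < Num.sqrt x by rewrite sqrtr_gt0.
have q0 : 0 < Num.sqrt y by rewrite sqrtr_gt0.
have lnE (z : R) : 0 < z -> ln z = 2 * ln (Num.sqrt z).
  move=> z0; rewrite -{1}(sqr_sqrtr (ltW z0)) lnXn ?sqrtr_gt0//.
  by rewrite mulr_natl.
have pq : Num.sqrt x <= Num.sqrt y by rewrite ler_wsqrtr.
have := @ln_mul_le R _ _ p0 q0; move: lx; rewrite (lnE x)// (lnE y)//.
by move: (ln _) (ln (Num.sqrt y)) => a b; nra.
Qed.

Lemma upper_comb_le (R : realType) (n : nat) : (12 <= n)%N ->
  ln_fact_comb R upper_comb n <=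
    n%:R * (ln 2 / 2 + ln 3 / 4) + 7 * ln n%:R.
Proof.
move=> n12.
have s12 c : c \in upper_comb -> (0 < c.2 <= n)%N.
  suff : all (fun c => 0 < c.2 <= 12)%N upper_comb.
    by move=> /allP h /h /andP[-> /leq_trans ->].
  by [].
have s0 : \sum_(c <- upper_comb) c.1%:~R / c.2%:R = 0 :> R.
  by rewrite /upper_comb !big_cons big_nil /=; lra.
have ln4 : ln (4 : R) = 2 * ln 2.
  by rewrite (_ : 4 = 2 * 2 :> R) ?lnM ?posrE//; lra.
have ln6 : ln (6 : R) = ln 2 + ln 3.
  by rewrite (_ : 6 = 2 * 3 :> R) ?lnM ?posrE//; lra.
have ln12 : ln (12 : R) = 2 * ln 2 + ln 3.
  by rewrite (_ : 12 = 4 * 3 :> R) ?lnM ?ln4 ?posrE//; lra.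
have sl : \sum_(c <- upper_comb) c.1%:~R * (ln c.2%:R / c.2%:R) =
    - (ln 2 / 2 + ln 3 / 4) :> R.
  by rewrite /upper_comb !big_cons big_nil /= ln4 ln6 ln12 ln1; lra.
have sc : \sum_(c <- upper_comb) c.1%:~R = -1 :> R.
  by rewrite /upper_comb !big_cons big_nil /=; lra.
have sa : \sum_(c <- upper_comb) `|c.1| = 7.
  by rewrite /upper_comb !big_cons big_nil.
have := @ln_fact_comb_approx R upper_comb n s12 s0; rewrite sl sc sa.
by move=> /ler_normlP[]; lra.
Qed.

(** The ln 5 terms cancel, as -1/5 + 1/10 + 1/15 + 1/40 + 1/120 = 0, so only ln 2 and ln 3 have to
    be compared later. *)
Lemma lower_comb_ge (R : realType) (n : nat) : (120 <= n)%N ->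
  n%:R * (3 / 10 * ln 2 + 7 / 40 * ln 3) - 12 * ln n%:R <=
    ln_fact_comb R lower_comb n.
Proof.
move=> n120.
have s120 c : c \in lower_comb -> (0 < c.2 <= n)%N.
  suff : all (fun c => 0 < c.2 <= 120)%N lower_comb.
    by move=> /allP h /h /andP[-> /leq_trans ->].
  by [].
have s0 : \sum_(c <- lower_comb) c.1%:~R / c.2%:R = 0 :> R.
  by rewrite /lower_comb !big_cons big_nil /=; lra.
have ln4 : ln (4 : R) = 2 * ln 2.
  by rewrite (_ : 4 = 2 * 2 :> R) ?lnM ?posrE//; lra.
have ln6 : ln (6 : R) = ln 2 + ln 3.
  by rewrite (_ : 6 = 2 * 3 :> R) ?lnM ?posrE//; lra.
have ln10 : ln (10 : R) = ln 2 + ln 5.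
  by rewrite (_ : 10 = 2 * 5 :> R) ?lnM ?posrE//; lra.
have ln12 : ln (12 : R) = 2 * ln 2 + ln 3.
  by rewrite (_ : 12 = 4 * 3 :> R) ?lnM ?ln4 ?posrE//; lra.
have ln15 : ln (15 : R) = ln 3 + ln 5.
  by rewrite (_ : 15 = 3 * 5 :> R) ?lnM ?posrE//; lra.
have ln40 : ln (40 : R) = 3 * ln 2 + ln 5.
  by rewrite (_ : 40 = 4 * 10 :> R) ?lnM ?ln4 ?ln10 ?posrE//; lra.
have ln120 : ln (120 : R) = 3 * ln 2 + ln 3 + ln 5.
  by rewrite (_ : 120 = 40 * 3 :> R) ?lnM ?ln40 ?posrE//; lra.
have sl : \sum_(c <- lower_comb) c.1%:~R * (ln c.2%:R / c.2%:R) =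
    - (3 / 10 * ln 2 + 7 / 40 * ln 3) :> R.
  rewrite /lower_comb !big_cons big_nil /=.
  by rewrite ln4 ln6 ln10 ln12 ln15 ln40 ln120 ln1; lra.
have sc : \sum_(c <- lower_comb) c.1%:~R = 2 :> R.
  by rewrite /lower_comb !big_cons big_nil /=; lra.
have sa : \sum_(c <- lower_comb) `|c.1| = 12.
  by rewrite /lower_comb !big_cons big_nil.
have := @ln_fact_comb_approx R lower_comb n s120 s0; rewrite sl sc sa.
by move=> /ler_normlP[]; lra.
Qed.

(** The constant of [lower_comb_ge] less the loss 2 ln 2 / 121 due to the primes up to n/121. *)
Definition lower_const (R : realType) : R :=
  (3 / 10 - 2 / 121) * ln 2 + 7 / 40 * ln 3.

Lemma sqrt_2X16 (R : realType) : Num.sqrt ((2 ^ 16)%N%:R : R) = 256.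
Proof.
have -> : ((2 ^ 16)%N%:R : R) = 256 ^+ 2 by rewrite natrX; lra.
by rewrite sqrtr_sqr ger0_norm.
Qed.

Lemma ln_2X16 (R : realType) : ln ((2 ^ 16)%N%:R : R) = 16 * ln 2.
Proof. by rewrite natrX lnXn// mulr_natl. Qed.

Lemma ln_le_sqrt (R : realType) (n : nat) : (2 ^ 16 <= n)%N ->
  16 * ln n%:R <= ln 2 * Num.sqrt (n%:R : R).
Proof.
move=> n16; have l2 := ln2_ge_half R.
have := @ln_sqrt_antitone R (2 ^ 16)%N%:R n%:R.
rewrite ln_2X16 sqrt_2X16 ler_nat n16 ltr0n expn_gt0 => /(_ isT isT).
by lra.
Qed.

(** The lower bound at k must be made uniform in k >= n. With s = sqrt n, t = sqrt k, w = s / ln n,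
    v = t / ln k and c the constant, v >= w and w c >= 1/2 give t v c - t/2 >= t (w c - 1/2) >= s (w
    c - 1/2). The term 25/2 is 12 + 1/2. *)
Lemma half_primes_ge (R : realType) (n k : nat) : (2 ^ 16 <= n)%N -> (n <= k)%N ->
  n%:R / ln n%:R * lower_const R - Num.sqrt n%:R / 2 - 25 / 2 <=
    (half_primes k)%:R :> R.
Proof.
move=> n16 nk; have l2 := ln2_ge_half R; have l3 := ln3_ge R.
have n0 : (0 < n)%N by apply: leq_trans n16; rewrite expn_gt0.
have n0R : 0 < n%:R :> R by rewrite ltr0n.
have k0R : 0 < k%:R :> R by rewrite ltr0n (leq_trans n0).
have nkR : n%:R <= k%:R :> R by rewrite ler_nat.
have ln16 : 16 * ln 2 <= ln (n%:R : R).
  by rewrite -ln_2X16 ler_ln ?posrE ?ltr0n ?expn_gt0// ler_nat.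
have lnk : ln (n%:R : R) <= ln k%:R by rewrite ler_ln ?posrE.
have k120 : (120 <= k)%N by apply: leq_trans nk; apply: leq_trans n16.
have low := @half_primes_lower R lower_comb 121 k isT (leq_trans n0 nk) lower_combP.
have {low} := le_trans (@lower_comb_ge R k k120) low.
have anti : ln k%:R * Num.sqrt (n%:R : R) <= ln n%:R * Num.sqrt k%:R.
  by apply: ln_sqrt_antitone => //; lra.
have nl := @ln_le_sqrt R n n16.
have sn0 : 0 < Num.sqrt (n%:R : R) by rewrite sqrtr_gt0.
have snk : Num.sqrt (n%:R : R) <= Num.sqrt k%:R by rewrite ler_wsqrtr.
have nE : n%:R = Num.sqrt n%:R * Num.sqrt n%:R :> R by rewrite -expr2 sqr_sqrtr.
have kE : k%:R = Num.sqrt k%:R * Num.sqrt k%:R :> R by rewrite -expr2 sqr_sqrtr.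
rewrite {1}nE {1 5}kE /lower_const.
move: (Num.sqrt _) (Num.sqrt k%:R) (ln n%:R) (ln k%:R) (ln 2) (ln 3)
  (half_primes k)%:R l2 l3 ln16 lnk anti nl sn0 snk.
move=> s t a b l2 l3 F hl2 hl3 ha ab anti nl s0 st low.
have a0 : 0 < a by lra.
have b0 : 0 < b by lra.
have vw : s / a <= t / b by rewrite ler_pdivrMr// mulrAC ler_pdivlMr//; lra.
have hw : 16 <= l2 * (s / a) by rewrite mulrA ler_pdivlMr.
have Fb : t * (t / b) * ((3 / 10 - 2 / 121) * l2 + 7 / 40 * l3) <=
    F + 25 / 2 + t / 2.
  rewrite mulrA mulrAC ler_pdivrMr//; lra.
rewrite [s * s / a]mulrAC; move: (s / a) (t / b) vw hw Fb => w v vw hw Fb.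
set c := (_ * l2 + _ * l3) in Fb *.
have c0 : 1 / 2 * l2 <= c by rewrite /c; lra.
have w0 : 0 < w by nra.
have wc : 1 / 2 <= w * c by nra.
have tw : t * (w * c) <= t * (v * c) by rewrite ler_wpM2l ?ler_wpM2r//; lra.
have : 0 <= (t - s) * (w * c - 1 / 2) by rewrite mulr_ge0; lra.
lra.
Qed.

(** The lower bound for k >= n is set against the upper bound at n/2; the main terms differ by a
    positive multiple of n / ln n, which outweighs sqrt n / 2. *)
Lemma half_primes_gap (R : realType) (n k : nat) : (2 ^ 16 <= n)%N -> (n <= k)%N ->
  (half_primes n./2)%:R + Num.sqrt (n%:R : R) / 5 - 41 / 2 <= (half_primes k)%:R.
Proof.
move=> n16 nk; have l2 := ln2_ge_half R; have l3 := ln3_ge R.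
apply: le_trans (@half_primes_ge R n k n16 nk).
have n0 : (0 < n)%N by apply: leq_trans n16; rewrite expn_gt0.
have n0R : 0 < n%:R :> R by rewrite ltr0n.
have ln16 : 16 * ln 2 <= ln (n%:R : R).
  by rewrite -ln_2X16 ler_ln ?posrE ?ltr0n ?expn_gt0// ler_nat.
have z24 : (24 <= n)%N by apply: leq_trans n16.
have z12 : (12 <= n./2)%N by lia.
have := le_trans (@half_primes_upper R upper_comb n./2 upper_combP)
  (@upper_comb_le R n./2 z12).
have lz : ln (n./2%:R : R) <= ln n%:R.
  by rewrite ler_ln ?posrE ?ltr0n ?ler_nat//; lia.
have lz1 : ln (n%:R : R) - ln 2 <= ln n./2.+1%:R.
  rewrite -ln_div ?posrE// ler_ln ?posrE ?divr_gt0// ler_pdivrMr// -natrM ler_nat.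
  lia.
have zn : n./2%:R <= n%:R / 2 :> R.
  by rewrite ler_pdivlMr// -natrM ler_nat; lia.
have nl := @ln_le_sqrt R n n16.
have sn0 : 0 < Num.sqrt (n%:R : R) by rewrite sqrtr_gt0.
have nE : n%:R = Num.sqrt n%:R * Num.sqrt n%:R :> R by rewrite -expr2 sqr_sqrtr.
have F0 : 0 <= (half_primes n./2)%:R :> R by [].
have z0 : 0 <= n./2%:R :> R by [].
rewrite nE in zn; rewrite {2}nE /lower_const.
move: n./2%:R (Num.sqrt _) (ln n%:R) (ln n./2%:R) (ln n./2.+1%:R) (ln 2) (ln 3)
  (half_primes n./2)%:R l2 l3 ln16 lz lz1 zn nl sn0 F0 z0.
move=> z s a lz lz1 l2 l3 F hl2 hl3 ha haz haz1 zs nl s0 F0 z0 up.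
have a0 : 0 < a by lra.
have hw : 16 <= l2 * (s / a) by rewrite mulrA ler_pdivlMr.
(* The logarithmic factor is at least ln n - 2 ln 2, and ln n >= 16 ln 2. *)
have FA : F * (7 / 8 * a) <= F * (lz1 - l2) by rewrite ler_wpM2l//; lra.
have zA : z * (l2 / 2 + l3 / 4) <= s * s / 2 * (l2 / 2 + l3 / 4).
  by rewrite ler_wpM2r//; lra.
have FB : F <= s * (s / a) * (2 / 7 * l2 + l3 / 7) + 8.
  rewrite mulrA -(ler_pM2r a0) mulrDl [X in _ <= X + _]mulrAC mulfVK ?gt_eqF//.
  lra.
rewrite [s * s / a]mulrAC; move: (s / a) hw FB => w hw FB.
(* Replacing ln 3 by 3/2 ln 2 leaves a coefficient just above 1/22. Then 16/22 = 8/11, and 8/11 -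
   1/2 = 5/22 exceeds 1/5. *)
have e0 : 1 / 22 * l2 <= (3 / 10 - 2 / 121) * l2 + 7 / 40 * l3 -
    (2 / 7 * l2 + l3 / 7) by lra.
have w0 : 0 < w by nra.
have we : 8 / 11 <= w * ((3 / 10 - 2 / 121) * l2 + 7 / 40 * l3 -
    (2 / 7 * l2 + l3 / 7)).
  by apply: (@le_trans _ _ (w * (1 / 22 * l2))); [lra|rewrite ler_wpM2l//; lra].
have := ler_wpM2l (ltW s0) we; lra.
Qed.

(** 1613 is the largest index in [chain], so the certified lower bounds persist beyond the range of
    the sieve. *)
Lemma half_primes_large (R : realType) (k : nat) : (2 ^ 16 <= k)%N ->
  (1613 <= half_primes k)%N.
Proof.
move=> k16; have := @half_primes_ge R (2 ^ 16) k (leqnn _) k16.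
have l2 := ln2_ge_half R; have l3 := ln3_ge R.
rewrite sqrt_2X16 ln_2X16 -(ler_nat R); apply: le_trans.
have -> : ((2 ^ 16)%N%:R : R) = 256 * 256 by rewrite natrX; lra.
have -> : 256 * 256 / (16 * ln 2) * lower_const R =
    4096 * (3 / 10 - 2 / 121) + 4096 * 7 / 40 * (ln 3 / ln 2) :> R.
  by rewrite /lower_const; field; lra.
have : 3 / 2 <= ln 3 / ln 2 :> R by rewrite ler_pdivlMr//; lra.
lra.
Qed.

(** * Ramanujan primes *)

Lemma count_uptoE (R : realType) (A : set nat) (x : R) : 0 <= x ->
  count_upto A x = size [seq p <- iota 0 (Num.truncn x).+1 | `[< A p >]].
Proof.
move=> x0; set s := [seq _ <- _ | _].
have sE p : (p \in s) = `[< A p /\ p%:R <= x >].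
  rewrite mem_filter mem_iota /= add0n ltnS truncn_ge_nat//.
  by apply/andP/asboolP => -[/asboolP].
have fin : finite_set [set p | A p /\ p%:R <= x].
  apply: (@sub_finite_set _ _ [set` s]); last exact: finite_seq.
  by move=> p /= Ap; rewrite sE; apply/asboolP.
rewrite /count_upto -(undup_id (_ : uniq s)) ?filter_uniq ?iota_uniq//.
rewrite -card_fseq; congr (#|` _|)%fset.
apply/fsetP => p; rewrite in_fset_set// !inE /= sE.
by apply/idP/asboolP; rewrite inE.
Qed.

Lemma truncn_half (R : realType) (x : R) : 0 <= x ->
  Num.truncn (x / 2) = (Num.truncn x)./2.
Proof.
move=> x0; have /andP[nx xn] := truncn_itv x0; set n := Num.truncn x in nx xn *.
apply: truncn_def; rewrite ler_pdivlMr// ltr_pdivrMr// -!natrM.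
apply/andP; split.
  by rewrite (le_trans _ nx)// ler_nat; lia.
by rewrite (lt_le_trans xn)// ler_nat; lia.
Qed.

Lemma primepiE (R : realType) (x : R) : 0 <= x ->
  primepi x = nprimes (Num.truncn x).
Proof.
move=> x0; rewrite /primepi count_uptoE// size_filter -sum1_count big_mkcond.
by apply: eq_bigr => p _; rewrite asboolb; case: (prime p).
Qed.

(** Both prime counts depend only on floor x, since floor(x/2) is the half of floor x; real
    arguments thus reduce to natural ones. *)
Lemma ramanujan_boundP (R : realType) (n m : nat) :
  ramanujan_bound R n m <-> forall k, (m <= k)%N -> (n <= half_primes k)%N.
Proof.
have E (x : R) : 0 <= x -> (n%:Z <= (primepi x)%:Z - (primepi (x / 2))%:Z) =
    (n <= half_primes (Num.truncn x))%N.
  move=> x0; rewrite !primepiE ?divr_ge0// truncn_half// nprimes_half.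
  by rewrite PoszD addrC addKr.
split=> [b k mk|b x mx].
  by have := b k%:R; rewrite E// natrK ler_nat; apply.
have x0 : 0 <= x by apply: le_trans mx.
by rewrite E//; apply: b; rewrite truncn_ge_nat.
Qed.

Lemma nth_ramanujan_itv (R : realType) (n a b : nat) :
    (forall k, (b <= k)%N -> (n <= half_primes k)%N) -> (half_primes a < n)%N ->
  exists2 m, is_nth_ramanujan R n m & (a < m <= b)%N.
Proof.
(* The case b = 0 would force n <= F(0) = 0, against F(a) < n. *)
move=> nb an; have b0 : (0 < b)%N.
  case: b nb => // /(_ 0%N isT); rewrite /half_primes subnn; lia.
have ex : exists m, (0 < m)%N && `[< ramanujan_bound R n m >].
  by exists b; rewrite b0; apply/asboolP/ramanujan_boundP.
case: (ex_minnP ex) => m /andP[m0 /asboolP mb] mmin.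
exists m; first by split=> // k k0 kb; apply: mmin; rewrite k0; apply/asboolP.
rewrite mmin ?b0//=; last by apply/asboolP/ramanujan_boundP.
rewrite ltnNge andbT; apply/negP => ma.
by move/ramanujan_boundP : mb => /(_ a ma); rewrite leqNgt an.
Qed.

(** By minimality F(m - 1) < n <= F(m), and F grows by at most 1 per step. *)
Lemma half_primes_ramanujan (R : realType) (n m : nat) : (0 < n)%N ->
  is_nth_ramanujan R n m -> half_primes m = n.
Proof.
move=> n0 [m0 /ramanujan_boundP mb mmin]; apply/eqP; rewrite eqn_leq mb// andbT.
case: m m0 mb mmin => // m _ mb mmin.
suff mn : (half_primes m < n)%N.
  have := half_primesS m; have := leq_b1 (prime m.+1); lia.
rewrite ltnNge; apply/negP => nm.
case: m mb mmin nm => [|m] mb mmin nm.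
  by move: nm; rewrite /half_primes subnn leqNgt n0.
suff /(mmin m.+1 isT) : ramanujan_bound R n m.+1 by rewrite ltnn.
apply/ramanujan_boundP => k; rewrite leq_eqVlt => /orP[/eqP <-//|].
exact: mb.
Qed.

(** The intervals [d, 2d) of consecutive entries leave no gap. *)
Lemma chain_cover (n : nat) (c : N * N) (ch : seq (N * N)) :
    path (fun c d => N.to_nat d.1 <= 2 * N.to_nat c.1)%N c ch ->
    (N.to_nat c.1 <= n < 2 * N.to_nat (last c ch).1)%N ->
  exists2 d, d \in c :: ch & (N.to_nat d.1 <= n < 2 * N.to_nat d.1)%N.
Proof.
elim: ch c => [|[d1 d2] ch IHch] [c1 c2] /=.
  by move=> _ cn; exists (c1, c2); rewrite ?mem_head.
move=> /andP[dc /IHch{}IHch] /andP[cn nl].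
have [nc|nc] := ltnP n (2 * N.to_nat c1).
  by exists (c1, c2); rewrite ?mem_head ?cn.
have [|e ech en] := IHch.
  by rewrite nl andbT (leq_trans dc).
by exists e => //; rewrite in_cons ech orbT.
Qed.

(** The interval (a, b] is taken with a = b - 1, which pins down the prime; the sieve covers
    arguments below 2^16 and [half_primes_large] the rest. *)
Lemma chain_ramanujan (R : realType) (c : N * N) : c \in chain ->
  is_nth_ramanujan R (N.to_nat c.2) (N.to_nat c.1) /\ (0 < N.to_nat c.2)%N.
Proof.
move=> cc; have [c1 cb] := @chainP c cc.
have c2 : (N.to_nat c.2 <= 1613)%N.
  have : all (fun c => N.leb c.2 1613) chain by [].
  by move=> /allP /(_ _ cc) /N.leb_le; move: c.2 => k; lia.
have [|m mR mc] := @nth_ramanujan_itv R _ _ (N.to_nat c.1) _ c1.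
  move=> k ck; have [k16|k16] := ltnP k (2 ^ 16); first by rewrite cb ?ck.
  by rewrite (leq_trans c2)// (@half_primes_large R).
have -> : N.to_nat c.1 = m by move: (N.to_nat c.1) mc => k mc; lia.
by split=> //; apply: leq_ltn_trans c1.
Qed.

Lemma ramanujan_prime_half_itv (R : realType) (n : nat) : (11 <= n)%N ->
  exists2 p, ramanujan_primes R p & (n./2 < p <= n)%N.
Proof.
move=> n11; have [n16|n16] := leqP (2 ^ 16) n.
  have [|m mR mn] := @nth_ramanujan_itv R (half_primes n./2).+1 n./2 n _ (ltnSn _).
    move=> k nk; have := @half_primes_gap R n k n16 nk.
    (* The gap is at least 256/5 - 41/2 > 0. *)
    have : 256 <= Num.sqrt (n%:R : R).
      by rewrite -sqrt_2X16 ler_wsqrtr// ler_nat.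
    by rewrite -(ltr_nat R); lra.
  by exists m => //; exists (half_primes n./2).+1.
have [||d dc dn] := @chain_cover n (11, 2)%num (behead chain).
- by vm_compute.
- apply/andP; split; first exact: n11.
  (* Twice the last entry is 2 * 32771 = 65542, which exceeds 2^16. *)
  by apply: leq_trans n16 _; vm_compute.
have [dR d0] := @chain_ramanujan R d dc.
exists (N.to_nat d.1); first by exists (N.to_nat d.2).
by move: (N.to_nat d.1) dn => k dn; lia.
Qed.

(** With h = F(n/2), the gap is at least (r + 21) - 41/2 >= r, so the Ramanujan primes of indices h
    + 1, ..., h + r all lie in (n/2, n]. They are distinct because F recovers the index. *)
Lemma ramanujanpi_sub_half_ge (R : realType) (r : nat) (x : R) : 0 <= x ->
    (2 ^ 16 <= Num.truncn x)%N -> ((5 * (r + 21)) ^ 2 <= Num.truncn x)%N ->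
  r%:R <= (ramanujanpi x)%:R - (ramanujanpi (x / 2))%:R :> R.
Proof.
move=> x0; rewrite /ramanujanpi !count_uptoE ?divr_ge0// truncn_half//.
move: (Num.truncn x) => n n16 nr; set h := half_primes n./2.
have sn : (5 * (r%:R + 21)) <= Num.sqrt (n%:R : R).
  rewrite -(@ger0_norm _ (5 * _)) ?mulr_ge0 ?addr_ge0// -sqrtr_sqr.
  rewrite ler_wsqrtr//; move: nr; rewrite -(ler_nat R).
  by rewrite natrX natrM natrD.
have /choice[f fP] : forall i, exists m, (i < r)%N ->
    is_nth_ramanujan R (h + i.+1) m /\ (n./2 < m <= n)%N.
  (* Outside the range of indices the value 0 is a mere filler. *)
  move=> i; have [ir|_] := ltnP i r; last by exists 0%N.
  have [||m mR mn] := @nth_ramanujan_itv R (h + i.+1) n./2 n; last by exists m.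
    move=> k nk; have := @half_primes_gap R n k n16 nk.
    have : i.+1%:R <= r%:R :> R by rewrite ler_nat.
    by rewrite -(ler_nat R) natrD -/h; lra.
  by rewrite -/h addnS ltnS leq_addr.
(* Cutting the list 0, ..., n after [n./2] turns the difference of counts into the size of its upper
   part. *)
have -> : n.+1 = (n./2.+1 + (n - n./2))%N by lia.
rewrite iotaD filter_cat size_cat natrD addrC addKr ler_nat add0n.
have <- : size [seq f i | i <- iota 0 r] = r by rewrite size_map size_iota.
apply: uniq_leq_size.
  rewrite map_inj_in_uniq ?iota_uniq// => i j; rewrite !mem_iota !add0n /=.
  move=> /fP[iR _] /fP[jR _] fij; rewrite fij in iR.
  have := @half_primes_ramanujan R _ _ (leq_trans _ (leq_addl h i.+1)) iR.
  rewrite (@half_primes_ramanujan R (h + j.+1) _ _ jR) ?addnS// => /(_ isT); lia.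
move=> p /mapP[i]; rewrite mem_iota add0n /= => /fP[iR ni] ->.
rewrite mem_filter mem_iota; apply/andP; split; last by lia.
by apply/asboolP; exists (h + i.+1)%N => //; rewrite addnS.
Qed.

Theorem theorem2 (R : realType) :
  (forall x : R, 11 <= x ->
     exists2 p : nat, ramanujan_primes R p & x / 2 < p%:R <= x) /\
  (fun x : R => (ramanujanpi x)%:R - (ramanujanpi (x / 2))%:R : R) @ +oo%R
    --> +oo%R.
Proof.
split=> [x x11|].
  have x0 : 0 <= x by lra.
  have /andP[nx xn] := truncn_itv x0.
  have [|p pR /andP[np pn]] := @ramanujan_prime_half_itv R (Num.truncn x).
    by rewrite truncn_ge_nat.
  (* With n = floor x, [n./2 < p] gives 2p >= n + 1 > x. *)
  exists p => //; rewrite -(truncn_ge_nat _ x0) pn andbT ltr_pdivrMr//.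
  by rewrite (lt_le_trans xn)// -natrM ler_nat; lia.
apply/cvgryPge => A; pose r := (Num.truncn A).+1.
pose M := maxn (2 ^ 16) ((5 * (r + 21)) ^ 2).
near=> x; have Mx : M%:R <= x by near: x; apply: nbhs_pinfty_ge; exact: num_real.
have x0 : 0 <= x by apply: le_trans Mx.
move: Mx; rewrite -truncn_ge_nat// geq_max => /andP[x16 xr].
apply: le_trans (@ramanujanpi_sub_half_ge R r x x0 x16 xr).
by rewrite ltW// truncnS_gt.
Unshelve. all: by end_near.
Qed.
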